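(* Suppose that $\Omega$ is a locally compact and $\sigma$-compact Hausdorff topological space. Then: (1) $\mathrm{u}(\mathrm{ru})=\mathrm{ucc}$ on $C(\Omega)$; (2) a subset of $C(\Omega)$ is order bounded iff it is bounded in the $\mathrm{ucc}$ topology; (3) a net in $C(\Omega)$ converges relatively uniformly iff it converges $\mathrm{ucc}$ and is eventually (order) bounded, i.e. some tail of it is (order) bounded; (4) relative uniform convergence on $C(\Omega)$ is unbounded iff $\Omega$ is compact.
   Context: $C(\Omega)$ is the vector lattice of all continuous real-valued functions on $\Omega$ with pointwise order. Convergences are given by specifying which nets converge to which points; they coincide if the same nets converge to the same limits. $\mathrm{ucc}$: $f_\alpha\to f$ if $f_\alpha\to f$ uniformly on every compact subset of $\Omega$; it is the convergence of a locally convex topology, and a set $A\subseteq C(\Omega)$ is bounded in it iff $\sup_{f\in A}\sup_{t\in K}|f(t)|<\infty$ for every compact $K\subseteq\Omega$. On a vector lattice $X$, $\mathrm{ru}$ (relative uniform convergence): $x_\alpha\to x$ if there is $e\in X_+$ such that for every $\varepsilon>0$ there is $\alpha_0$ with $|x_\alpha-x|\le\varepsilon e$ for all $\alpha\ge\alpha_0$. For a convergence $\eta$ on $X$, the unbounded modification $\mathrm{u}\eta$ is given by: $x_\alpha\to x$ in $\mathrm{u}\eta$ iff $|x_\alpha-x|\wedge u\to 0$ in $\eta$ for every $u\in X_+$. The convergence $\eta$ is unbounded if $\mathrm{u}\eta=\eta$. In (3), in view of (2), it is immaterial whether boundedness of a tail is understood in the order or in the $\mathrm{ucc}$ sense. 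*)

(* Defs.v *)
From HB Require Import structures.
From mathcomp Require Import all_boot all_order all_algebra.
From mathcomp Require Import all_classical all_reals all_analysis.

Set Implicit Arguments.
Unset Strict Implicit.
Unset Printing Implicit Defensive.

Import Order.TTheory GRing.Theory Num.Theory.
Import numFieldNormedType.Exports.

Local Open Scope classical_set_scope.
Local Open Scope ring_scope.

(* A vector lattice over [R]. The suprema and infima are fields of the structure
   because Order.Lattice and GRing.Lmodule cannot be joined here: realDomainType
   already inherits from both Order.Lattice and GRing.Zmodule. *)
HB.mixin Record isVectorLattice (R : numDomainType) X
    & Num.POrderedZmodule X & GRing.Lmodule R X := {
  vl_meet : X -> X -> X;
  vl_join : X -> X -> X;
  vl_le_meet : forall x y z : X, (x <= vl_meet y z) = (x <= y) && (x <= z);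
  vl_ge_join : forall x y z : X, (vl_join x y <= z) = (x <= z) && (y <= z);
  vl_leD2r : forall x y z : X, x <= y -> x + z <= y + z;
  vl_scale_ge0 : forall (a : R) (x : X), 0 <= a -> 0 <= x -> 0 <= a *: x
}.

#[short(type = "vectorLatticeType")]
HB.structure Definition VectorLattice (R : numDomainType) :=
  {X of Num.POrderedZmodule X & GRing.Lmodule R X & isVectorLattice R X}.

Definition vl_abs (R : numDomainType) (X : vectorLatticeType R) (x : X) : X :=
  vl_join x (- x).

Record directedSet := DirectedSet {
  dir_sort :> Type;
  dir_le : dir_sort -> dir_sort -> Prop;
  dir_inhabited : inhabited dir_sort;
  dir_refl : forall a, dir_le a a;
  dir_trans : forall a b c, dir_le a b -> dir_le b c -> dir_le a c;
  dir_upper : forall a b, exists c, dir_le a c /\ dir_le b c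
}.

Definition tails (I : directedSet) : set_system I :=
  [set A | exists a0, forall a, dir_le a0 a -> A a].

Instance tails_filter (I : directedSet) : ProperFilter (@tails I).
Proof.
split; last split.
- by case=> a0 /(_ _ (dir_refl a0)).
- by have [a] := dir_inhabited I; exists a.
- move=> P Q [a Pa] [b Qb]; have [c [ac bc]] := dir_upper a b.
  by exists c => d cd; split; [apply: Pa|apply: Qb]; apply: dir_trans cd.
- by move=> P Q PQ [a Pa]; exists a => b /Pa /PQ.
Qed.

(* [eta I x l] reads: the net [x] indexed by [I] converges to [l]. *)
Definition convergence (X : Type) :=
  forall I : directedSet, (I -> X) -> X -> Prop.

Definition same_convergence (X : Type) (eta1 eta2 : convergence X) :=
  forall (I : directedSet) (x : I -> X) (l : X), eta1 I x l <-> eta2 I x l.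

Definition eventually_in (X : Type) (B : set X -> Prop) (I : directedSet)
    (x : I -> X) :=
  exists a0, B [set x a | a in [set a | dir_le a0 a]].

Section vector_lattice_convergences.
Context (R : numDomainType) (X : vectorLatticeType R).

Definition ru : convergence X := fun I x l =>
  exists2 e : X, 0 <= e &
    forall eps : R, 0 < eps ->
      exists a0, forall a, dir_le a0 a -> vl_abs (x a - l) <= eps *: e.

Definition unbounded_modification (eta : convergence X) : convergence X :=
  fun I x l =>
    forall u : X, 0 <= u -> eta I (fun a => vl_meet (vl_abs (x a - l)) u) 0.

Definition unbounded_convergence (eta : convergence X) :=
  same_convergence (unbounded_modification eta) eta.

Definition order_bounded (A : set X) :=
  exists a b : X, forall x, A x -> a <= x <= b.

End vector_lattice_convergences.

Definition sigma_compact (T : topologicalType) :=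
  exists2 K : nat -> set T, (forall n, compact (K n)) & \bigcup_n K n = setT.

Definition contfun (R : realType) (Omega : topologicalType) :=
  continuousType Omega R.

Section contfun_vector_lattice.
Context (R : realType) (Omega : topologicalType).
Local Notation C := (contfun R Omega).
Implicit Types f g h : C.

HB.instance Definition _ := Choice.on C.

Definition cf_fun f : Omega -> R := f.
Coercion cf_fun : contfun >-> Funclass.

Lemma cf_continuous f : continuous f.
Proof. exact: cts_fun. Qed.

Lemma cf_eqP f g : f = g <-> f =1 g.
Proof. exact: continuousEP. Qed.

Definition cf_pack (f : Omega -> R) (cf : continuous f) : C :=
  (mkcts cf : continuousType Omega R).

Let add_cts f g : continuous (fun t => f t + g t).
Proof. by move=> t; apply: cvgD; exact: cf_continuous. Qed.
Let opp_cts f : continuous (fun t => - f t).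
Proof. by move=> t; apply: cvgN; exact: cf_continuous. Qed.
Let scale_cts (a : R) f : continuous (fun t => a * f t).
Proof. by move=> t; apply: cvgMr; exact: cf_continuous. Qed.
Let min_cts f g : continuous (fun t => Num.min (f t) (g t)).
Proof. by move=> t; apply: continuous_min; exact: cf_continuous. Qed.
Let max_cts f g : continuous (fun t => Num.max (f t) (g t)).
Proof. by move=> t; apply: continuous_max; exact: cf_continuous. Qed.
Let zero_cts : continuous (fun _ : Omega => 0 : R).
Proof. exact: cst_continuous. Qed.

Definition cf_zero : C := cf_pack zero_cts.
Definition cf_add f g : C := cf_pack (@add_cts f g).
Definition cf_opp f : C := cf_pack (@opp_cts f).
Definition cf_scale a f : C := cf_pack (@scale_cts a f).
Definition cf_min f g : C := cf_pack (@min_cts f g).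
Definition cf_max f g : C := cf_pack (@max_cts f g).
Definition cf_le f g : bool := `[< forall t, f t <= g t >].

Let addA : associative cf_add.
Proof. by move=> f g h; apply/cf_eqP => t; exact: addrA. Qed.
Let addC : commutative cf_add.
Proof. by move=> f g; apply/cf_eqP => t; exact: addrC. Qed.
Let add0 : left_id cf_zero cf_add.
Proof. by move=> f; apply/cf_eqP => t; exact: add0r. Qed.
Let addN : left_inverse cf_zero cf_opp cf_add.
Proof. by move=> f; apply/cf_eqP => t; exact: addNr. Qed.

HB.instance Definition _ := GRing.isZmodule.Build C addA addC add0 addN.

Let scaleA a b f : cf_scale a (cf_scale b f) = cf_scale (a * b) f.
Proof. by apply/cf_eqP => t; exact: mulrA. Qed.
Let scale1 : left_id 1 cf_scale.
Proof. by move=> f; apply/cf_eqP => t; exact: mul1r. Qed.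
Let scaleDr : right_distributive cf_scale +%R.
Proof. by move=> a f g; apply/cf_eqP => t; exact: mulrDr. Qed.
Let scaleDl f : {morph cf_scale^~ f : a b / a + b}.
Proof. by move=> a b; apply/cf_eqP => t; exact: mulrDl. Qed.

HB.instance Definition _ :=
  GRing.Zmodule_isLmodule.Build R C scaleA scale1 scaleDr scaleDl.

Let le_refl : reflexive cf_le.
Proof. by move=> f; apply/asboolP. Qed.
Let le_anti : antisymmetric cf_le.
Proof.
move=> f g /andP[/asboolP fg /asboolP gf]; apply/cf_eqP => t.
by apply/le_anti/andP; split.
Qed.
Let le_trans : transitive cf_le.
Proof.
move=> g f h /asboolP fg /asboolP gh; apply/asboolP => t.
exact: le_trans (fg t) (gh t).
Qed.

HB.instance Definition _ :=
  Order.Le_isPOrder.Build ring_display C le_refl le_anti le_trans.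

Let le_minP f g h : (f <= cf_min g h) = (f <= g) && (f <= h).
Proof.
apply/asboolP/andP => [fgh|[/asboolP fg /asboolP fh] t].
  by split; apply/asboolP => t; move: (fgh t); rewrite le_min => /andP[].
by rewrite /= le_min fg fh.
Qed.
Let ge_maxP f g h : (cf_max f g <= h) = (f <= h) && (g <= h).
Proof.
apply/asboolP/andP => [fgh|[/asboolP fg /asboolP fh] t].
  by split; apply/asboolP => t; move: (fgh t); rewrite ge_max => /andP[].
by rewrite /= ge_max fg fh.
Qed.

Lemma cf_leP f g : reflect (forall t, f t <= g t) (f <= g).
Proof. exact: asboolP. Qed.

Let leD2r f g h : f <= g -> f + h <= g + h.
Proof. by move=> /cf_leP fg; apply/cf_leP => t; rewrite lerD2r. Qed.
Let scale_ge0 (a : R) f : 0 <= a -> 0 <= f -> 0 <= a *: f.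
Proof. by move=> a0 /cf_leP f0; apply/cf_leP => t; exact: (mulr_ge0 a0 (f0 t)). Qed.

HB.instance Definition _ :=
  isVectorLattice.Build R C le_minP ge_maxP leD2r scale_ge0.

Lemma cf_zeroE t : (0 : C) t = 0. Proof. by []. Qed.
Lemma cf_addE f g t : (f + g : C) t = f t + g t. Proof. by []. Qed.
Lemma cf_oppE f t : (- f : C) t = - f t. Proof. by []. Qed.
Lemma cf_scaleE a f t : (a *: f : C) t = a * f t. Proof. by []. Qed.
Lemma cf_meetE f g t : (vl_meet f g : C) t = Num.min (f t) (g t).
Proof. by []. Qed.
Lemma cf_joinE f g t : (vl_join f g : C) t = Num.max (f t) (g t).
Proof. by []. Qed.
Lemma cf_absE f t : (vl_abs f : C) t = `|f t|.
Proof. exact: maxrN. Qed.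

End contfun_vector_lattice.

Definition ucc_space (R : realType) (Omega : topologicalType) :=
  initial_topology
    (fun f : contfun R Omega => (f : {family compact, Omega -> R})).

Section ucc.
Context (R : realType) (Omega : topologicalType).
Local Notation C := (contfun R Omega).

Definition ucc : convergence C := fun I x l =>
  x @ @tails I --> (l : ucc_space R Omega).

(* Boundedness in the sense of topological vector spaces: [A] is absorbed by
   every neighbourhood of the origin. *)
Definition ucc_bounded (A : set C) :=
  forall U : set C, nbhs (0 : ucc_space R Omega) U ->
    exists2 r : R, 0 < r & A `<=` [set r *: g | g in U].

Lemma ucc_nbhsP (f : C) (U : set C) :
  nbhs (f : ucc_space R Omega) U <->
  exists K, compact K /\ exists2 eps : R, 0 < eps &
    [set g : C | forall t, K t -> `|f t - g t| < eps] `<=` U.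
Proof.
split=> [[_ /= [[W oW <-] /= Wf] WU]|[K [cK [eps e0 KU]]]].
  pose F : set_system (Omega -> R) := [set V | exists K, compact K /\
    exists2 eps : R, 0 < eps &
      [set g : Omega -> R | forall t, K t -> `|f t - g t| < eps] `<=` V].
  have FF : Filter F.
    split.
    - exists set0; split; first exact: compact0.
      by exists 1.
    - move=> P Q [K [cK [e e0 KP]]] [L [cL [d d0 LQ]]].
      exists (K `|` L); split; first exact: compactU.
      exists (Num.min e d); first by rewrite lt_min e0.
      move=> g /= KLg; split; [apply: KP|apply: LQ] => t Kt;
        have := KLg t; rewrite lt_min => /(_ _)/andP[] //; by [left|right].
    - move=> P Q PQ [K [cK [e e0 KP]]]; exists K; split => //.
      by exists e => //; apply: subset_trans KP PQ.
  have : {family compact, F --> (f : Omega -> R)}.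
    apply/fam_cvgP => K cK V /uniform_nbhs[E [/= entE EV]].
    move: entE; rewrite -entourage_ballE => -[e /= e0 eE].
    by exists K; split => //; exists e => // g Kg; apply: EV => t Kt; apply/eE/Kg.
  move=> /(_ W)[|K [cK [e e0 KW]]].
    exact: (@open_nbhs_nbhs {family compact, Omega -> R}).
  exists K; split => //; exists e => // g Kg.
  by apply: WU; exact: KW.
have : nbhs (f : {family compact, Omega -> R})
    [set g | forall t, K t -> `|f t - g t| < eps].
  apply: (@fam_nbhs _ _ _ K [set xy : R * R | `|xy.1 - xy.2| < eps]) => //.
  by rewrite -entourage_ballE; exists eps.
move=> fK; apply: (@filterS _ (nbhs (f : ucc_space R Omega)) _ _ _ KU).
exact: (@initial_continuous _ {family compact, Omega -> R}
  (fun f : C => (f : {family compact, Omega -> R})) f _ fK).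
Qed.

Lemma uccP (I : directedSet) (x : I -> C) (l : C) :
  ucc x l <->
  forall K, compact K -> forall eps : R, 0 < eps ->
    exists a0, forall a, dir_le a0 a -> forall t, K t -> `|x a t - l t| <= eps.
Proof.
split=> [xl K cK eps e0|xl U /ucc_nbhsP[K [cK [eps e0 KU]]]].
  have /xl[a0 Ka0] : nbhs (l : ucc_space R Omega)
      [set g : C | forall t, K t -> `|l t - g t| < eps].
    by apply/ucc_nbhsP; exists K; split=> //; exists eps.
  by exists a0 => a /Ka0 /= Ka t /Ka; rewrite distrC => /ltW.
have [|a0 Ka0] := xl K cK (eps / 2); first by rewrite divr_gt0.
exists a0 => a /Ka0 Ka; apply: KU => t /Ka; rewrite distrC => /le_lt_trans; apply.
by rewrite ltr_pdivrMr// ltr_pMr// ltr1n.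
Qed.

Lemma ucc_boundedP (A : set C) :
  ucc_bounded A <->
  forall K, compact K ->
    exists M : R, forall f, A f -> forall t, K t -> `|f t| <= M.
Proof.
split=> [bA K cK|bA U /ucc_nbhsP[K [cK [eps e0 KU]]]].
  have [|r r0 Ar] := bA [set g : C | forall t, K t -> `|(0 : C) t - g t| < 1].
    by apply/ucc_nbhsP; exists K; split=> //; exists 1.
  exists r => _ /Ar[g Kg <-] t /Kg; rewrite cf_zeroE sub0r normrN cf_scaleE normrM.
  by rewrite gtr0_norm// => /ltW; exact: ler_piMr (ltW r0).
have [M AM] := bA K cK.
pose r := (`|M| + 1) / eps.
have r0 : 0 < r by rewrite divr_gt0// ltr_wpDl.
exists r => // f Af; exists (r^-1 *: f : C); last first.
  by rewrite scalerA mulfV ?gt_eqF// scale1r.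
apply: KU => t Kt; rewrite cf_zeroE sub0r normrN cf_scaleE normrM.
rewrite gtr0_norm ?invr_gt0// mulrC ltr_pdivrMr// /r mulrC divfK ?gt_eqF//.
by rewrite (le_lt_trans (AM f Af t Kt))// (le_lt_trans (ler_norm M))// ltrDl.
Qed.

End ucc.

(* Main.v *)
Require Import Defs.
From mathcomp Require Import all_boot all_order all_algebra.
From mathcomp Require Import all_classical all_reals all_analysis.

Set Implicit Arguments.
Unset Strict Implicit.
Unset Printing Implicit Defensive.

Import Order.TTheory GRing.Theory Num.Theory.
Import numFieldNormedType.Exports.

Local Open Scope classical_set_scope.
Local Open Scope ring_scope.

(** Every inclusion between these convergences that can be read off a compact set
    holds because a continuous function is bounded there: an inequality
    |x_a - l| <= eps * e, or the same one truncated at the constant 1, becomes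
    uniform smallness on each compact set.

    The converse inclusions need a regulator e that copes with the part of the
    space outside the compact sets. It comes from [exists_fast_growth]: Omega is
    exhausted by compact sets L n in such a way that, for any prescribed
    constants c n, some continuous function is at least c n off L n, for all n at
    once. Two choices of c carry the whole proposition.
    - With c n = n one gets a function h tending to infinity. For u >= 0 the
      function h * u + 1 regulates every truncation |x_a - l| /\ u of a ucc
      convergent net: off a large L n one has u <= eps * h * u, while on L n the
      net itself is eventually below eps. Hence u(ru) = ucc
      ([ucc_unbounded_ru]).
    - With c n the bound on L n.+1 of a ucc bounded set one gets an order bound of
      that set ([ucc_bounded_order_bounded]).
    If a ucc convergent net has a tail bounded by some u, then truncating
    |x_a - l| at u + |l| changes nothing on that tail, so u(ru) = ucc turns ucc
    convergence into ru convergence ([unbounded_ru_order_bounded]); conversely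
    l - e and l + e bound a tail of an ru convergent net with regulator e.

    If Omega is compact, ucc is ru with regulator 1, so that u(ru) = ucc = ru. If
    Omega is not compact, h is unbounded, and the functions c * (h - n)^+,
    indexed by n and c but directed by n alone, form a ucc null net no tail of
    which is order bounded; such a net cannot converge in ru, so u(ru) <> ru. *)

(** * Continuous functions growing at a prescribed rate *)

(** The one-point compactification is compact Hausdorff, hence normal, so the
    compact set K and the point at infinity are separated by a continuous g with
    g = 0 on K and g = 1 at infinity. The set where g > 1/2 is a neighbourhood of
    infinity, that is, contains the complement of a compact set L, and the ramp
    is 2 g. Local compactness enters only here. *)
Lemma exists_ramp (R : realType) (Omega : topologicalType) (K : set Omega) :
  hausdorff_space Omega -> locally_compact [set: Omega] -> compact K ->
  exists (L : set Omega) (f : Omega -> R),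
    [/\ compact L, continuous f, forall t, 0 <= f t,
        forall t, K t -> f t = 0 & forall t, ~ L t -> 1 <= f t].
Proof.
move=> hO lcO cK; pose opc := one_point_compactification Omega.
have hopc : hausdorff_space opc by exact: one_point_compactification_hausdorff.
have nopc : normal_space opc.
  exact: (compact_normal hopc one_point_compactification_compact).
have Some_cts : continuous (Some : Omega -> opc).
  exact: one_point_compactification_some_continuous.
have clK : closed ((Some : Omega -> opc) @` K).
  apply: (compact_closed hopc); apply: continuous_compact cK.
  exact: continuous_subspaceT.
have cl_infty : closed [set (None : opc)].
  by apply: (compact_closed hopc); exact: compact_set1.
have KI0 : (Some : Omega -> opc) @` K `&` [set None] = set0.
  by apply/seteqP; split=> // _ [[t _ <-]].
have /(@uniform_separatorP _ R)[g [g_cts g01 gK ginfty]] :=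
  iffLR (@normal_separatorP R _) nopc _ _ clK cl_infty KI0.
have g_infty : g None = 1 by apply: ginfty; exists None.
have half_nbhs : nbhs (g None) [set r : R | 1 / 2 < r].
  by rewrite g_infty; apply: lt_nbhsr; rewrite ltr_pdivrMr// mul1r ltr1n.
have [L [cL _] Lg] := g_cts None _ half_nbhs.
exists L, (fun t => 2 * g (Some t)); split => //.
- move=> t; apply: cvgMr; exact: (continuous_comp (@Some_cts t) (@g_cts _)).
- move=> t; rewrite mulr_ge0//.
  by have /itvP -> : g (Some t) \in `[0, 1] by apply: g01; exists (Some t).
- move=> t Kt; have -> : g (Some t) = 0; last by rewrite mulr0.
  by apply: gK; exists (Some t) => //; exists t.
- move=> t nLt; rewrite mulrC -ler_pdivrMr//; apply/ltW/Lg.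
  by left; exists t.
Qed.

(** Each L n.+1 is the compact set off which a ramp for the union of L n and the
    n-th given compact set is at least 1. The ramp vanishes on L n, so its
    continuity makes L n.+1 a neighbourhood of L n: interiors need not be mentioned. *)
Lemma exists_ramp_exhaustion (R : realType) (Omega : topologicalType) :
  hausdorff_space Omega -> locally_compact [set: Omega] ->
  sigma_compact Omega ->
  exists (L : nat -> set Omega) (f : nat -> Omega -> R),
    [/\ forall n, compact (L n), forall t, exists n, L n t,
        forall n, L n `<=` L n.+1 &
        forall n, [/\ continuous (f n), forall t, 0 <= f n t,
          forall t, L n t -> f n t = 0 & forall t, ~ L n.+1 t -> 1 <= f n t]].
Proof.
move=> hO lcO [K cK KT].
(* The compactness of A is moved inside the existential, so that the choice
   function is defined on all sets and can be iterated. *)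
have /choice[L LP] : forall A : set Omega, exists L : set Omega,
    compact A -> compact L /\ exists f : Omega -> R,
      [/\ continuous f, forall t, 0 <= f t,
        forall t, A t -> f t = 0 & forall t, ~ L t -> 1 <= f t].
  move=> A; have [cA|ncA] := pselect (compact A); last by exists A.
  have [L [f [cL fc f0 fA fL]]] := exists_ramp R hO lcO cA.
  by exists L => _; split => //; exists f.
pose M := fix M n := if n is m.+1 then L (M m `|` K m) else set0.
have cM n : compact (M n).
  elim: n => [|n IHn]; first exact: compact0.
  by have [] := LP _ (compactU IHn (cK n)).
have /choice[f fP] : forall n, exists f : Omega -> R,
    [/\ continuous f, forall t, 0 <= f t,
      forall t, (M n `|` K n) t -> f t = 0 & forall t, ~ M n.+1 t -> 1 <= f t].
  by move=> n; have [] := LP _ (compactU (cM n) (cK n)).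
have sub n t : (M n `|` K n) t -> M n.+1 t.
  move=> MKt; have [_ _ f0 f1] := fP n.
  by apply: contrapT => /f1; rewrite f0// ler10.
exists M, f; split=> //.
- move=> t; have [n _ Knt] : (\bigcup_n K n) t by rewrite KT.
  by exists n.+1; apply: sub; right.
- by move=> n t Mt; apply: sub; left.
- by move=> n; have [? ? f0 ?] := fP n; split => // t Mt; apply: f0; left.
Qed.

(** With ramps f k that vanish on L k and are at least 1 off L k.+1, the function is
    \sum_k (c k)^+ * f k. The sum is locally finite: only the terms k <= n can be
    nonzero on the neighbourhood L n.+1 of a point of L n. *)
Lemma exists_fast_growth (R : realType) (Omega : topologicalType) :
  hausdorff_space Omega -> locally_compact [set: Omega] ->
  sigma_compact Omega ->
  exists L : nat -> set Omega,
    [/\ forall n, compact (L n), forall t, exists n, L n t &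
        forall c : nat -> R, exists2 e : contfun R Omega, 0 <= e &
          forall n t, ~ L n t -> c n <= e t].
Proof.
move=> hO lcO scO.
have [L [f [cL L_cover L_sub fP]]] := exists_ramp_exhaustion R hO lcO scO.
have f_cts n : continuous (f n) by have [] := fP n.
have f_ge0 n t : 0 <= f n t by have [] := fP n.
have f0 n t : L n t -> f n t = 0 by have [_ _ /(_ t)] := fP n.
have f1 n t : ~ L n.+1 t -> 1 <= f n t by have [_ _ _ /(_ t)] := fP n.
have L_mono m n : (m <= n)%N -> L m `<=` L n.
  move=> /subnK <-; elim: (n - m)%N => // k IHk.
  exact: subset_trans IHk (L_sub _).
(* The shift matches the ramps, which reach 1 off L n.+1. *)
exists (fun n => L n.+1); split => // [t|c].
  by have [n Lt] := L_cover t; exists n; exact: L_sub.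
pose d n := Num.max (c n) 0.
have d_ge0 n : 0 <= d n by rewrite le_max lexx orbT.
pose S N t := \sum_(0 <= k < N) d k * f k t.
have S_cts N : continuous (S N).
  apply: (@continuous_big _ _ +%R 0) => [|k _ t].
    exact: add_continuous.
  by apply: cvgMr; exact: f_cts.
have S_stable m n t : (m <= n)%N -> L m t -> S n t = S m t.
  move=> mn Lmt; rewrite /S (big_cat_nat (leq0n m) mn)//=.
  rewrite [X in _ + X]big_nat_cond [X in _ + X]big1 ?addr0//.
  move=> k /andP[/andP[mk _] _].
  by rewrite f0 ?mulr0//; exact: L_mono Lmt.
(* The infinite sum at t is its partial sum of length N t, where t is in L (N t). *)
have [N LN] := choice L_cover.
have S_eq n t : L n t -> S (N t) t = S n t.
  move=> Lnt; have [nN|Nn] := leqP n (N t); first exact: S_stable.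
  by apply/esym/S_stable => //; exact: ltnW.
have e_cts : continuous (fun t => S (N t) t).
  move=> t; rewrite /prop_for /continuous_at (S_eq _ _ (L_sub _ _ (LN t))).
  apply: cvg_trans (S_cts (N t).+1 t); apply: near_eq_cvg.
  have lt1_nbhs : nbhs (f (N t) t) [set r : R | r < 1].
    by apply: lt_nbhsl; rewrite f0 ?ltr01.
  apply: (@filterS _ (nbhs t) _ _ _ _ (f_cts (N t) t _ lt1_nbhs)) => s /= fs.
  by apply/esym/S_eq; apply: contrapT => /f1; rewrite leNgt fs.
exists (cf_pack e_cts) => [|n t nLt].
  by apply/cf_leP => t; apply: sumr_ge0 => k _; exact: mulr_ge0.
have nN : (n < N t)%N.
  rewrite ltnNge; apply/negP => Nn; apply: nLt.
  by apply: L_mono (LN t); exact: leqW.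
change (c n <= S (N t) t).
rewrite /S (bigD1_seq n) ?iota_uniq ?mem_index_iota//=.
rewrite -[leLHS]addr0 lerD//; last first.
  by apply: sumr_ge0 => k _; exact: mulr_ge0.
apply: (@le_trans _ _ (d n)); first by rewrite le_max lexx.
by rewrite ler_peMr// f1.
Qed.

(** * Pointwise forms of order notions *)

Section pointwise.
Context (R : realType) (Omega : topologicalType).
Local Notation C := (contfun R Omega).

Lemma ruP (I : directedSet) (x : I -> C) (l : C) :
  ru x l <-> exists2 e : C, 0 <= e & forall eps : R, 0 < eps ->
    exists a0, forall a, dir_le a0 a ->
      forall t, `|x a t - l t| <= eps * e t.
Proof.
by split=> -[e e0 xl]; exists e => // eps /xl[a0 xa0]; exists a0 => a /xa0;
  [move=> /cf_leP + t => /(_ t); rewrite cf_absE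
  |move=> H; apply/cf_leP => t; rewrite cf_absE; exact: H].
Qed.

Lemma unbounded_ruP (I : directedSet) (x : I -> C) (l : C) :
  unbounded_modification (@ru R C) x l <->
  forall u : C, 0 <= u -> exists2 e : C, 0 <= e & forall eps : R, 0 < eps ->
    exists a0, forall a, dir_le a0 a ->
      forall t, Num.min `|x a t - l t| (u t) <= eps * e t.
Proof.
have minE (u : C) a t : 0 <= u ->
  `|(vl_meet (vl_abs (x a - l)) u : C) t - (0 : C) t| =
  Num.min `|x a t - l t| (u t).
  move=> /cf_leP u0; rewrite cf_zeroE subr0 cf_meetE cf_absE.
  by apply: ger0_norm; rewrite le_min normr_ge0; exact: u0.
by split=> xl u u0; [have /ruP[e e0 xe] := xl u u0|
  apply/ruP; have [e e0 xe] := xl u u0]; exists e => // eps /xe[a0 xa0];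
  exists a0 => a /xa0 xa t; have := xa t; rewrite minE.
Qed.

Lemma cf_bounded_on_compact (f : C) (K : set Omega) : compact K ->
  exists2 M : R, 0 < M & forall t, K t -> `|f t| <= M.
Proof.
move=> cK; have : bounded_set (f @` K).
  apply/compact_bounded/continuous_compact => //.
  by apply: continuous_subspaceT; exact: cf_continuous.
move=> /ex_strict_bound_gt0[M M0 fM]; exists M => // t Kt.
by apply/ltW/fM; exists t.
Qed.

Definition cf_one : C := cf_pack (@cst_continuous Omega R 1).

Lemma order_boundedP (A : set C) :
  order_bounded A <-> exists2 e : C, 0 <= e & forall f, A f ->
    forall t, `|f t| <= e t.
Proof.
split=> [[a [b Aab]]|[e e0 Ae]].
  exists (vl_join (vl_abs a) (vl_abs b)).
    by apply/cf_leP => t; rewrite cf_joinE le_max !cf_absE normr_ge0.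
  move=> f /Aab/andP[/cf_leP af /cf_leP fb] t.
  rewrite cf_joinE !cf_absE le_max; apply/orP.
  have [f0|/ltW f0] := leP 0 (f t).
    by right; rewrite ger0_norm// (le_trans (fb t))// ler_norm.
  by left; rewrite ler0_norm// -normrN (le_trans _ (ler_norm _))// lerN2.
exists (- e), e => f /Ae Af; apply/andP; split; apply/cf_leP => t.
  by have := Af t; rewrite ler_norml cf_oppE => /andP[].
by have := Af t; rewrite ler_norml => /andP[].
Qed.

(** * Consequences of boundedness on compact sets *)

(** Truncation at the constant 1 is harmless once the target accuracy is below 1,
    and a regulator is bounded by some M on a compact set; the accuracy d / M of the
    truncated net thus gives accuracy d there. *)
Lemma unbounded_ru_ucc (I : directedSet) (x : I -> C) (l : C) :
  unbounded_modification (@ru R C) x l -> ucc x l.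
Proof.
have one_ge0 : 0 <= cf_one by apply/cf_leP => t; exact: ler01.
move=> /unbounded_ruP/(_ _ one_ge0)[e _ xe]; apply/uccP => K cK eps eps0.
have [M M0 eM] := cf_bounded_on_compact e cK.
(* A bound below 1 on min (|x a t - l t|, 1) cannot come from the 1. *)
pose d := Num.min eps (1 / 2).
have d0 : 0 < d by rewrite lt_min eps0/= divr_gt0.
have [|a0 xa0] := xe (d / M); first by rewrite divr_gt0.
exists a0 => a /xa0 xa t Kt.
have : Num.min `|x a t - l t| 1 <= d.
  apply: le_trans (xa t) _; rewrite mulrAC ler_pdivrMr// ler_pM2l//.
  exact: le_trans (ler_norm _) (eM t Kt).
rewrite ge_min !le_min => /orP[/andP[]//|/andP[_]].
by rewrite ler_pdivlMr// mul1r lern1.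
Qed.

Lemma ru_ucc (I : directedSet) (x : I -> C) (l : C) : ru x l -> ucc x l.
Proof.
move=> /ruP[e _ xe]; apply/uccP => K cK eps eps0.
have [M M0 eM] := cf_bounded_on_compact e cK.
have [|a0 xa0] := xe (eps / M); first by rewrite divr_gt0.
exists a0 => a /xa0 xa t Kt; apply: le_trans (xa t) _.
rewrite mulrAC ler_pdivrMr// ler_pM2l//.
exact: le_trans (ler_norm _) (eM t Kt).
Qed.

Lemma ru_eventually_order_bounded (I : directedSet) (x : I -> C) (l : C) :
  ru x l -> eventually_in (@order_bounded R C) x.
Proof.
move=> /ruP[e _ /(_ 1 ltr01)[a0 xa0]]; exists a0.
exists (l - e), (l + e) => _ [a /xa0 xa <-].
by apply/andP; split; apply/cf_leP => t; have := xa t;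
  rewrite mul1r ler_distl => /andP[].
Qed.

Lemma order_bounded_ucc_bounded (A : set C) : order_bounded A -> ucc_bounded A.
Proof.
move=> /order_boundedP[e _ Ae]; apply/ucc_boundedP => K cK.
have [M _ eM] := cf_bounded_on_compact e cK; exists M => f Af t Kt.
exact: le_trans (Ae f Af t) (le_trans (ler_norm _) (eM t Kt)).
Qed.

(** On a tail bounded by u, |x_a - l| <= u + |l|, so the truncation at u + |l| is
    the identity there. *)
Lemma unbounded_ru_order_bounded (I : directedSet) (x : I -> C) (l : C) :
  unbounded_modification (@ru R C) x l ->
  eventually_in (@order_bounded R C) x -> ru x l.
Proof.
move=> xl [b0 /order_boundedP[u u0 xu]]; apply/ruP.
have w0 : 0 <= u + vl_abs l.
  apply/cf_leP => t; rewrite cf_addE cf_absE addr_ge0//; exact: (cf_leP _ _ u0).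
have [e e0 xe] := iffLR (unbounded_ruP x l) xl _ w0.
exists e => // eps /xe[a0 xa0].
have [c [ac bc]] := dir_upper a0 b0; exists c => a ca t.
have := xa0 a (dir_trans ac ca) t; rewrite cf_addE cf_absE min_l//.
rewrite (le_trans (ler_normB _ _))// lerD2r xu//.
by exists a => //; exact: dir_trans ca.
Qed.

Lemma compact_ucc_ru (I : directedSet) (x : I -> C) (l : C) :
  compact [set: Omega] -> ucc x l -> ru x l.
Proof.
move=> cO /uccP/(_ _ cO) xl; apply/ruP.
exists cf_one => [|eps /xl[a0 xa0]]; first by apply/cf_leP => t; exact: ler01.
by exists a0 => a /xa0 xa t; rewrite mulr1; exact: xa.
Qed.

(** * Regulators on locally compact sigma-compact spaces *)

Section locally_compact_sigma_compact.
Context (hO : hausdorff_space Omega) (lcO : locally_compact [set: Omega])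
  (scO : sigma_compact Omega).

(** If M n bounds A on L n, a function which is at least M n.+1 off L n dominates A
    on each L n.+1 minus L n; the constant |M 0| takes care of L 0. *)
Lemma ucc_bounded_order_bounded (A : set C) : ucc_bounded A -> order_bounded A.
Proof.
have [L [cL L_cover growth]] := exists_fast_growth R hO lcO scO.
move=> /ucc_boundedP bA.
have /choice[M AM] n := bA _ (cL n).
have [e e0 Me] := growth (fun n => M n.+1).
apply/order_boundedP; exists (e + `|M 0%N| *: cf_one) => [|f Af t].
  apply/cf_leP => t; rewrite cf_addE cf_scaleE addr_ge0//.
    exact: (cf_leP _ _ e0).
  by rewrite mulr_ge0//; exact: ler01.
have et0 : 0 <= e t by exact: (cf_leP _ _ e0).
rewrite cf_addE cf_scaleE [cf_one t]/(1 : R) mulr1.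
have [n] := L_cover t; elim: n => [L0t|n IHn Lt].
  by rewrite (le_trans (AM 0%N f Af t L0t))// (le_trans (ler_norm _))// lerDr.
have [//|nLt] := pselect (L n t).
by rewrite (le_trans (AM _ f Af t Lt))// (le_trans (Me n t nLt))// lerDl.
Qed.

(** The regulator h * u + 1 does not depend on the net: where h >= 1 / eps the
    truncation at u is small by itself, and the rest lies in a compact set, on which
    ucc convergence and the summand 1 suffice. *)
Lemma ucc_unbounded_ru (I : directedSet) (x : I -> C) (l : C) :
  ucc x l -> unbounded_modification (@ru R C) x l.
Proof.
have [L [cL _ growth]] := exists_fast_growth R hO lcO scO.
have [h /cf_leP h0 hL] := growth (fun n => n%:R).
move=> /uccP xl; apply/unbounded_ruP => u /cf_leP u0.
have e_cts : continuous (fun t => h t * u t + 1).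
  move=> t; apply: cvgD; last exact: cvg_cst.
  by apply: cvgM; exact: cf_continuous.
have hu0 t : 0 <= h t * u t by rewrite mulr_ge0//; [exact: h0|exact: u0].
exists (cf_pack e_cts) => [|eps eps0].
  by apply/cf_leP => t; exact: addr_ge0.
pose n := Num.truncn eps^-1.
have [a0 xa0] := xl _ (cL n.+1) eps eps0; exists a0 => a /xa0 xa t.
change (Num.min `|x a t - l t| (u t) <= eps * (h t * u t + 1)).
rewrite mulrDr mulr1 ge_min; apply/orP.
have [/xa xat|nLt] := pselect (L n.+1 t); [left|right].
  by rewrite (le_trans xat)// lerDr mulr_ge0// ltW.
apply: (@le_trans _ _ (eps * (h t * u t))); last by rewrite lerDl ltW.
rewrite mulrA ler_peMl//; first exact: u0.
rewrite mulrC -ler_pdivrMr// mul1r (le_trans _ (hL _ _ nLt))//.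
by apply/ltW/truncnS_gt.
Qed.

(** No sequence can witness the failure: a ucc convergent one is bounded on every
    compact set, hence order bounded, hence ru convergent. This is why the net
    c * (h - n)^+ leaves the scalar c free along each tail. *)
Lemma unbounded_ru_compact :
  unbounded_convergence (@ru R C) -> compact [set: Omega].
Proof.
have [L [cL _ growth]] := exists_fast_growth R hO lcO scO.
have [h _ hL] := growth (fun n => n%:R).
move=> uru; apply: contrapT => ncO.
have h_unbounded n : exists t, n%:R < h t.
  apply: contrapT => h_le; apply: ncO; rewrite (_ : setT = L n.+1)//.
  apply/seteqP; split=> // t _; apply: contrapT => nLt; apply: h_le.
  by exists t; rewrite (lt_le_trans _ (hL _ t nLt))// ltr_nat.
(* Pairs (n, c) are compared by n only, so every tail contains all c. *)
pose le_fst (p q : nat * R) := is_true (p.1 <= q.1)%N.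
have le_fst_trans p q r : le_fst p q -> le_fst q r -> le_fst p r.
  exact: leq_trans.
have le_fst_upper p q : exists r, le_fst p r /\ le_fst q r.
  by exists (maxn p.1 q.1, 0); rewrite /le_fst leq_maxl leq_maxr.
pose I := DirectedSet (inhabits (0%N, 0)) (fun p => leqnn p.1)
  le_fst_trans le_fst_upper.
pose x (p : I) : C := p.2 *: vl_join (h - p.1%:R *: cf_one) 0.
have xE p t : x p t = p.2 * Num.max (h t - p.1%:R) 0.
  rewrite /x cf_scaleE cf_joinE cf_addE cf_oppE cf_scaleE cf_zeroE.
  by rewrite [cf_one t]/(1 : R) mulr1.
have /ucc_unbounded_ru/uru/ruP[e _ /(_ 1 ltr01)[[n c] xe]] : ucc x (0 : C).
  apply/uccP => K cK eps eps0; have [M M0 hM] := cf_bounded_on_compact h cK.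
  exists ((Num.truncn M).+1, 0) => p Mp t Kt.
  rewrite cf_zeroE subr0 xE max_r ?mulr0 ?normr0; first exact: ltW.
  rewrite subr_le0 (le_trans (ler_norm _))// (le_trans (hM t Kt))//.
  by rewrite (le_trans (ltW (truncnS_gt _)))// ler_nat.
have [t nt] := h_unbounded n.
have d0 : 0 < h t - n%:R by rewrite subr_gt0.
have := xe (n, (`|e t| + 1) / (h t - n%:R)) (leqnn _) t.
rewrite cf_zeroE subr0 xE /= (max_l (ltW d0)) divfK ?gt_eqF// mul1r.
rewrite ger0_norm ?addr_ge0// leNgt => /negP; apply.
by rewrite (le_lt_trans (ler_norm _))// ltrDl.
Qed.
End locally_compact_sigma_compact.
End pointwise.

Theorem proposition5p14 (R : realType) (Omega : topologicalType)
    (hausdorffOmega : hausdorff_space Omega)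
    (locally_compactOmega : locally_compact [set: Omega])
    (sigma_compactOmega : sigma_compact Omega) :
  [/\ same_convergence
        (unbounded_modification (@ru R (contfun R Omega))) (@ucc R Omega),
      forall A : set (contfun R Omega), order_bounded A <-> ucc_bounded A,
      forall (I : directedSet) (x : I -> contfun R Omega)
          (l : contfun R Omega),
        (ru x l <-> ucc x l /\ eventually_in (@order_bounded R _) x) /\
        (ru x l <-> ucc x l /\ eventually_in (@ucc_bounded R Omega) x)
    & unbounded_convergence (@ru R (contfun R Omega)) <->
        compact [set: Omega]].
Proof.
have uruE : same_convergence
    (unbounded_modification (@ru R (contfun R Omega))) (@ucc R Omega).
  by move=> I x l; split; [exact: unbounded_ru_ucc|exact: ucc_unbounded_ru].
have bddE (A : set (contfun R Omega)) : order_bounded A <-> ucc_bounded A.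
  split; first exact: order_bounded_ucc_bounded.
  exact: ucc_bounded_order_bounded.
have ruE (I : directedSet) (x : I -> contfun R Omega) (l : contfun R Omega) :
    ru x l <-> ucc x l /\ eventually_in (@order_bounded R _) x.
  split=> [xl|[/uruE xl bx]]; last exact: unbounded_ru_order_bounded xl bx.
  by split; [exact: ru_ucc|exact: ru_eventually_order_bounded xl].
split=> // [I x l|].
  split; first exact: ruE.
  by split=> [/ruE|] [xl [a0 bx]]; [|apply/ruE]; split=> //; exists a0;
    exact/bddE.
split=> [|cO I x l]; first exact: unbounded_ru_compact.
split=> [/uruE|/ru_ucc/uruE//]; exact: compact_ucc_ru.
Qed.
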